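(* Let $T = (T_1,\ldots,T_n) \in \mathcal{B}(\mathcal{H})^n$ be a commuting tuple of bounded operators on a Hilbert space $\mathcal{H}$, let $\mathcal{E}$ be a Hilbert space and let $\Pi : H^2_n(\mathcal{E}) \to \mathcal{H}$ be a partial isometry with $\Pi M_{z_i} = T_i\Pi$ for $i=1,\ldots,n$. Then $\mathcal{S} = \Pi(H^2_n(\mathcal{E}))$ is a closed $T$-invariant subspace, $\mathcal{W} = \mathcal{S} \ominus \sum_{i=1}^n T_i\mathcal{S}$ is a wandering subspace for $T|_{\mathcal{S}}$, and $$\mathcal{W} = \Pi\big((\ker \Pi)^{\perp} \cap \mathcal{E}\big).$$
   Context: All Hilbert spaces are complex; $\mathbb{N}$ contains $0$. A subspace $\mathcal{S}$ is $T$-invariant if $T_i\mathcal{S}\subset\mathcal{S}$ for all $i$, and $T|_{\mathcal{S}} = (T_1|_{\mathcal{S}},\ldots,T_n|_{\mathcal{S}})$. For a closed subspace $\mathcal{M}$ and a (not necessarily closed) linear subspace $\mathcal{L}\subset\mathcal{M}$, $\mathcal{M}\ominus\mathcal{L}$ denotes $\mathcal{M}\cap\mathcal{L}^\perp$. A closed subspace $\mathcal{W}$ of a Hilbert space is a wandering subspace for a commuting tuple $R=(R_1,\ldots,R_n)$ of bounded operators on it if $\mathcal{W} \perp R^{k}\mathcal{W}$ for all $k \in \mathbb{N}^n\setminus\{0\}$, where $R^k = R_1^{k_1}\cdots R_n^{k_n}$. $H^2_n(\mathcal{E})$ is the $\mathcal{E}$-valued Drury-Arveson space, i.e. the $\mathcal{E}$-valued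 reproducing kernel Hilbert space of analytic functions on the open unit ball $\mathbb{B}^n\subset\mathbb{C}^n$ with kernel $(1-\sum_{i=1}^n z_i\bar w_i)^{-1} I_{\mathcal{E}}$; $M_{z_i}$ denotes multiplication by the $i$-th coordinate function on it. The space $\mathcal{E}$ is identified with the closed subspace of constant functions in $H^2_n(\mathcal{E})$. *)

(* Defs.v *)
From HB Require Import structures.
From mathcomp Require Import all_boot all_order all_algebra.
From mathcomp Require Import complex.
From mathcomp Require Import boolp classical_sets functions reals topology normedtype.

Set Implicit Arguments.
Unset Strict Implicit.
Unset Printing Implicit Defensive.

Import Order.TTheory GRing.Theory Num.Theory.
Import numFieldNormedType.Exports.

Local Open Scope classical_set_scope.
Local Open Scope complex_scope.
Local Open Scope ring_scope.

(* Complex Hilbert spaces: the inner product is linear in its first argument,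
   and the norm of the underlying complete normed space is the one it
   induces. *)
HB.mixin Record isHilbert (R : realType) H
    of CompleteNormedModule R[i] H := {
  hdot : {dot H for (@Num.conj R[i])};
  hdot_norm : forall x : H, hdot x x = `|x| ^+ 2
}.

#[short(type="hilbertType")]
HB.structure Definition Hilbert (R : realType) :=
  {H of isHilbert R H & CompleteNormedModule R[i] H}.

Section Hilbert_space.
Variables (R : realType) (H : hilbertType R).
Implicit Types (A B : set H).

Definition closed_subspace A : Prop :=
  [/\ A 0, forall (a : R[i]) (x y : H), A x -> A y -> A (a *: x + y)
    & closed A].

Definition orthogonal_sets A B : Prop :=
  forall x y, A x -> B y -> hdot x y = 0.

Definition perp A : set H := [set x | forall y, A y -> hdot x y = 0].

Definition ominus A B : set H := A `&` perp B.

End Hilbert_space.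

Section Operators.
Variables (R : realType) (H K : hilbertType R).

Definition bounded_operator (f : {linear H -> K}) : Prop :=
  exists M : R, forall x, `|f x| <= M%:C * `|x|.

Definition op_ker (f : {linear H -> K}) : set H := [set x | f x = 0].

Definition partial_isometry (f : {linear H -> K}) : Prop :=
  bounded_operator f /\ forall x, perp (op_ker f) x -> `|f x| = `|x|.

End Operators.

Section Tuples.
Variables (R : realType) (H : hilbertType R) (n : nat).
Implicit Types (T : 'I_n -> {linear H -> H}) (S W : set H).

Definition commuting_tuple T : Prop :=
  forall (i j : 'I_n) (x : H), T i (T j x) = T j (T i x).

Definition invariant_subspace T S : Prop := forall (i : 'I_n) x, S x -> S (T i x).

Definition tuple_pow T (k : 'I_n -> nat) : H -> H :=
  \big[comp/idfun]_(i < n) iter (k i) (T i).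

Definition sum_images T S : set H :=
  [set x | exists2 s : 'I_n -> H,
     forall i, S (s i) & x = \sum_(i < n) T i (s i)].

(* W is a wandering subspace for the restriction of T to the closed
   T-invariant subspace S.  The powers of the restricted tuple are the
   restrictions of the powers of T, so they are written as the latter. *)
Definition wandering_restr T S W : Prop :=
  [/\ closed_subspace S, invariant_subspace T S, closed_subspace W, W `<=` S
    & forall k : 'I_n -> nat, (exists i, k i != 0%N) ->
        orthogonal_sets W (tuple_pow T k @` W)].

End Tuples.

(* An E-valued reproducing kernel Hilbert space on X with operator-valued
   kernel k : a Hilbert space of functions X -> E (the linear injection
   rkhs_fun sends an element to the function it is), containing each
   k(., w) e, and in which <f, k(., w) e> = <f(w), e>. The kernel
   determines the space up to the unitary respecting rkhs_fun. *)
Record rkhs (R : realType) (X : Type) (E : hilbertType R)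
    (k : X -> X -> E -> E) := RKHS {
  rkhs_space :> hilbertType R;
  rkhs_fun : {linear rkhs_space -> (X -> E)};
  rkhs_fun_inj : injective rkhs_fun;
  rkhs_ker : X -> E -> rkhs_space;
  rkhs_kerE : forall w e z, rkhs_fun (rkhs_ker w e) z = k z w e;
  rkhs_reproducing : forall f w e,
    hdot f (rkhs_ker w e) = hdot (rkhs_fun f w) e
}.

Section Drury_Arveson.
Variables (R : realType) (n : nat) (E : hilbertType R).

Definition unit_ball : Type :=
  {z : 'rV[R[i]]_n | \sum_(i < n) `|z 0 i| ^+ 2 < 1}.

Definition ball_coord (z : unit_ball) (i : 'I_n) : R[i] := \val z 0 i.

Definition drury_arveson_kernel (z w : unit_ball) (e : E) : E :=
  (1 - \sum_(i < n) ball_coord z i * (ball_coord w i)^*)^-1 *: e.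

(* The elements of such a space are automatically analytic on the ball, as
   the kernel is analytic in z and locally bounded on the diagonal. *)
Definition drury_arveson := rkhs drury_arveson_kernel.

Variable F : drury_arveson.

(* Multiplication by the i-th coordinate function: coordinate functions are
   multipliers, so the set below is always a singleton and the default
   value 0 is never used. *)
Definition Mz (i : 'I_n) (f : F) : F :=
  xget 0 [set g : F | forall z : unit_ball,
    rkhs_fun F g z = ball_coord z i *: rkhs_fun F f z].

Definition constants : set F :=
  [set f | exists e : E, forall z : unit_ball, rkhs_fun F f z = e].

End Drury_Arveson.

(* Main.v *)
(* As [P] preserves the inner product of a vector of (ker P)^perp with any
   vector, a vector [P f] with [f] in (ker P)^perp is orthogonal to every
   [T_i P g = P (z_i g)] iff [f] is orthogonal to every [z_i g].  The latter
   means that [f] is constant, because the kernel functions satisfy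
     k_w e = e + sum_i conj(w_i) z_i k_w e
   and span a dense subspace.
   That z_i is a multiplier of H^2_n follows from the identity
     ||h||^2 - sum_i ||A_i h||^2 = ||sum_j e_j||^2
   for h = sum_j k_{w_j} e_j and A_i h = sum_j conj(w_{j,i}) k_{w_j} e_j: it
   makes A_i a contraction, and z_i is its adjoint. *)
Require Import Defs.
From HB Require Import structures.
From mathcomp Require Import all_boot all_order all_algebra.
From mathcomp Require Import complex ring lra.
From mathcomp Require Import boolp classical_sets functions reals topology normedtype.

Set Implicit Arguments.
Unset Strict Implicit.
Unset Printing Implicit Defensive.

Import Order.TTheory GRing.Theory Num.Theory.
Import numFieldNormedType.Exports.

Local Open Scope classical_set_scope.
Local Open Scope ring_scope.

(** * Real parts, algebra of the inner product and the Cauchy-Schwarz inequality *)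

Lemma ReD (R : rcfType) (a b : R[i]) : complex.Re (a + b) = complex.Re a + complex.Re b.
Proof. by case: a; case: b. Qed.

Lemma Re_conj (R : rcfType) (a : R[i]) : complex.Re (Num.conj a) = complex.Re a.
Proof. by case: a. Qed.

Section Hilbert_basics.
Variables (R : realType) (H : hilbertType R).
Local Notation C := R[i].
Local Notation "''[' u , v ]" := (hdot u v) : ring_scope.
Implicit Types (u v w : H).

Lemma hdotC u v : '[u, v] = Num.conj '[v, u].
Proof. by rewrite (hermC (@hdot R H)) expr0 mul1r. Qed.

Lemma hdotDl u v w : '[u + v, w] = '[u, w] + '[v, w].
Proof. exact: linearDl. Qed.

Lemma hdotDr u v w : '[u, v + w] = '[u, v] + '[u, w].
Proof. exact: linearDr. Qed.

Lemma hdotBl u v w : '[u - v, w] = '[u, w] - '[v, w].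
Proof. exact: linearBl. Qed.

Lemma hdotBr u v w : '[u, v - w] = '[u, v] - '[u, w].
Proof. exact: linearBr. Qed.

Lemma hdotZl (a : C) u v : '[a *: u, v] = a * '[u, v].
Proof. exact: linearZl_LR. Qed.

Lemma hdotZr (a : C) u v : '[u, a *: v] = Num.conj a * '[u, v].
Proof. exact: linearZr_LR. Qed.

Lemma hdot0l u : '[0, u] = 0.
Proof. exact: linear0l. Qed.

Lemma hdot0r u : '[u, 0] = 0.
Proof. exact: linear0r. Qed.

Lemma hdot_suml I r (Q : pred I) (F : I -> H) u :
  '[\sum_(i <- r | Q i) F i, u] = \sum_(i <- r | Q i) '[F i, u].
Proof. exact: linear_sumlz. Qed.

Lemma hdot_sumr I r (Q : pred I) (F : I -> H) u :
  '[u, \sum_(i <- r | Q i) F i] = \sum_(i <- r | Q i) '[u, F i].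
Proof. exact: linear_sumr. Qed.

Lemma hdot_eq0 u : '[u, u] = 0 -> u = 0.
Proof. by rewrite hdot_norm => /eqP; rewrite expf_eq0 normr_eq0 => /eqP. Qed.

Lemma hdot_injr u v : (forall w, '[w, u] = '[w, v]) -> u = v.
Proof.
move=> uv; apply/eqP; rewrite -subr_eq0; apply/eqP/hdot_eq0.
by rewrite hdotBr uv subrr.
Qed.

Lemma CauchySchwarz_hdot u v : `|'[u, v]| <= `|u| * `|v|.
Proof.
have [->|v0] := eqVneq v 0; first by rewrite hdot0r !normr0 mulr0.
have vgt0 : 0 < `|v| ^+ 2 by rewrite exprn_gt0 ?normr_gt0.
rewrite -ler_sqr ?nnegrE ?mulr_ge0// exprMn -subr_ge0.
suff : 0 <= (`|u| ^+ 2 * `|v| ^+ 2 - `|'[u, v]| ^+ 2) * `|v| ^+ 2.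
  by rewrite pmulr_lge0.
(* The vector on the right is [|v| ^+ 2] times the component of [u] orthogonal to [v], which avoids
   dividing. *)
have -> : (`|u| ^+ 2 * `|v| ^+ 2 - `|'[u, v]| ^+ 2) * `|v| ^+ 2 =
    `|(`|v| ^+ 2 *: u - '[u, v] *: v)| ^+ 2.
  rewrite -!hdot_norm !(hdotBl, hdotBr, hdotZl, hdotZr) normCK.
  have -> : Num.conj '[v, v] = '[v, v].
    by rewrite -hdotC.
  by rewrite (hdotC v u); ring.
by rewrite exprn_ge0.
Qed.

End Hilbert_basics.

(** * Riesz representation of bounded functionals given by a graph *)

Section Riesz.
Variables (R : realType) (H : hilbertType R).
Local Notation C := R[i].
Local Notation "''[' u , v ]" := (hdot u v) : ring_scope.
Implicit Types (u v w : H).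

Lemma closureP (A : set H) x :
  closure A x <-> forall e : C, 0 < e -> exists2 y, A y & `|x - y| < e.
Proof.
split=> [Ax e e0|Ax B /nbhs_ballP[e e0 Be]].
  have [y [Ay]] := Ax _ (nbhsx_ballx x e e0).
  by rewrite -ball_normE => xy; exists y.
have [y Ay xy] := Ax e e0.
by exists y; split=> //; apply: Be; rewrite -ball_normE.
Qed.

Let q u : R := complex.Re '[u, u].

Let qE u : (q u)%:C%C = '[u, u].
Proof. by apply: RRe_real; rewrite hdot_norm realX// normr_real. Qed.

Let q_norm u : (q u)%:C%C = `|u| ^+ 2.
Proof. by rewrite qE hdot_norm. Qed.

Let q_ge0 u : 0 <= q u.
Proof. by rewrite -ler0c q_norm exprn_ge0. Qed.

Let qD u v : q (u + v) = q u + q v + 2 * complex.Re '[u, v].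
Proof.
by rewrite /q hdotDl !hdotDr !ReD (hdotC v u) Re_conj; ring.
Qed.

Let qZ (a : C) u : q (a *: u) = complex.Re (a * Num.conj a) * q u.
Proof.
rewrite {1}/q hdotZl hdotZr -qE mulrA.
by case: a => x y /=; ring.
Qed.

(* A functional that is bounded on a subspace, given by its graph [D]: the
   representing vector is the limit of the minimizing sequences of
   [|h|^2 - 2 Re c] over [D h c]. *)
Variables (D : H -> C -> Prop) (M : R).
Hypothesis D0 : D 0 0.
Hypothesis DP : forall a h c h' c', D h c -> D h' c' ->
  D (a *: h + h') (a * c + c').
Hypothesis Dbounded : forall h c, D h c -> `|c| <= M%:C%C * `|h|.

(** When [c = '[h, g]], this is |h - g|^2 - |g|^2, so making it small brings [h] close to [g]. *)
Let J h (c : C) : R := q h - 2 * complex.Re c.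

Let values : set R := [set r | exists h c, D h c /\ r = J h c].

(** Completing the square: |h|^2 - 2 M |h| + M^2 is the square of |h| - M. *)
Let J_bounded h c : D h c -> - M ^+ 2 <= J h c.
Proof.
move=> /Dbounded hc.
have : (complex.Re c)%:C%C <= M%:C%C * `|h|.
  apply: le_trans hc; apply: le_trans (normc_ge_Re c).
  by rewrite lecR ler_norm.
have [r hr] : exists r : R, `|h| = r%:C%C.
  by apply/complex_realP; rewrite normr_real.
have : q h = r ^+ 2 by apply: complexI; rewrite q_norm hr rmorphXn.
rewrite /J hr -rmorphM /= lecR => -> rM.
have := sqr_ge0 (r - M); nra.
Qed.

Let has_inf_values : has_inf values.
Proof.
split; first by exists (J 0 0), 0, 0.
by exists (- M ^+ 2) => _ [h [c [Dhc ->]]]; exact: J_bounded.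
Qed.

Let m := inf values.

Let J_ge h c : D h c -> m <= J h c.
Proof.
by move=> Dhc; apply: ge_inf; [case: has_inf_values|exists h, c].
Qed.

Let near_min (e : R) : set H := [set h | exists2 c, D h c & J h c < m + e].

(** Parallelogram law: |h - h'|^2 / 2 is the sum of [J] at [h] and [h'] minus twice [J] at their
    midpoint, and the latter value is at least [m]. *)
Let near_min_dist e h h' : near_min e h -> near_min e h' -> q (h - h') <= 4 * e.
Proof.
move=> [c Dhc Jc] [c' Dhc' Jc'].
have /J_ge : D (2^-1 *: h + 2^-1 *: h') (2^-1 * c + 2^-1 * c').
  apply: DP => //; rewrite -[_ *: h']addr0 -[_ * c']addr0; exact: DP.
move: Jc Jc'; rewrite /J -scalerDr -mulrDr qZ.
have -> : complex.Re (2^-1 * Num.conj 2^-1 : C) = 4^-1.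
  have -> : (2^-1 : C) = (2^-1)%:C%C by rewrite fmorphV rmorph_nat.
  by rewrite /=; field.
have -> : complex.Re (2^-1 * (c + c')) = 2^-1 * (complex.Re c + complex.Re c').
  have -> : (2^-1 : C) = (2^-1)%:C%C by rewrite fmorphV rmorph_nat.
  by rewrite -ReD; case: (c + c') => x y /=; ring.
have -> : q (h - h') = q h + q h' - 2 * complex.Re '[h, h'].
  rewrite -scaleN1r qD qZ hdotZr.
  have -> : complex.Re (-1 * Num.conj (-1) : C) = 1 by rewrite /=; ring.
  have -> : complex.Re (Num.conj (-1) * '[h, h']) = - complex.Re '[h, h'].
    by case: '[h, h'] => x y /=; ring.
  by ring.
rewrite qD => *; lra.
Qed.

(** First variation: moving [h] along [k] against the error [delta] lowers [J] by an amount
    proportional to |delta|^2, but [J] cannot drop by more than [e]. *)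
Let near_min_dot e h c k d : D h c -> J h c < m + e -> D k d ->
  complex.Re (('[k, h] - d) * Num.conj ('[k, h] - d)) <= e * (q k + 1).
Proof.
move=> Dhc Jhc Dkd; set delta := '[k, h] - d.
have q1 : 0 < q k + 1 by rewrite ltr_wpDl.
(* With this step length [t * q k = 1 - t], and the drop of [J] is exactly t N (1 + t). *)
pose t := (q k + 1)^-1.
have t0 : 0 < t by rewrite invr_gt0.
have tq : t * q k = 1 - t by rewrite /t; field; rewrite gt_eqF.
have /J_ge := DP (- t%:C%C * Num.conj delta) Dkd Dhc.
rewrite /J qD qZ ReD.
set a := - t%:C%C * Num.conj delta.
set N := complex.Re (delta * Num.conj delta).
have -> : complex.Re (a * Num.conj a) = t ^+ 2 * N.
  by rewrite /a /N {a N}; case: delta => x y /=; ring.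
have N0 : 0 <= N by rewrite /N {a N}; case: delta => x y /=; nra.
have : complex.Re '[a *: k, h] - complex.Re (a * d) = - t * N.
  rewrite hdotZl.
  have -> : '[k, h] = delta + d by rewrite subrK.
  rewrite mulrDr ReD /a /N {a N N0}.
  by case: delta => x y; case: (d) => x' y' /=; ring.
move=> aE Jge.
have : t * N <= e.
  suff : t * N * (1 + t) <= e by have := mulr_ge0 (ltW t0) N0; nra.
  have -> : t * N * (1 + t) = 2 * t * N - t * N * (t * q k) by rewrite tq; ring.
  move: Jhc; rewrite /J; nra.
by rewrite /t mulrC ler_pdivrMr.
Qed.

(** Near-minimizers converge to [g], and [near_min_dot] passes to the limit. As [D] is a relation,
    it may be given on representations of vectors: [DP] and [Dbounded] force it to be
    single-valued. *)
Lemma Riesz_graph : exists2 g, closure [set h | exists c, D h c] g &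
  forall h c, D h c -> c = '[h, g].
Proof.
(* The sets [near_min e] are a filter base, so no minimizing sequence has to be chosen. *)
pose F := filter_from [set e : R | 0 < e] near_min.
have near_minS e e' : e <= e' -> near_min e `<=` near_min e'.
  move=> ee' h [c Dhc Jc]; exists c => //.
  by apply: lt_le_trans Jc _; rewrite lerD2l.
have near_min0 e : 0 < e -> near_min e !=set0.
  move=> e0; have [_ [h [c [Dhc ->]]] Jc] := inf_adherent e0 has_inf_values.
  by exists h, c.
have FF : ProperFilter F.
  apply: filter_from_proper => //; apply: filter_from_filter; first by exists 1 => /=.
  move=> e e' /= e0 e'0; exists (Num.min e e'); first by rewrite /= lt_min e0.
  by move=> h hm; split; apply: near_minS hm; rewrite ge_min lexx ?orbT.
have cF : cvg F.
  apply: (@cauchy_cvg H F FF); apply: cauchy_exP => e e0.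
  have [r er] : exists r : R, e = r%:C%C.
    by apply/complex_realP; rewrite realE ltW.
  have r0 : 0 < r by move: e0; rewrite er ltcR.
  (* By [near_min_dist], this tolerance bounds |h - h'|^2 by r^2 / 2 < r^2. *)
  have s0 : 0 < r ^+ 2 / 8 by rewrite divr_gt0 ?exprn_gt0.
  have [h hm] := near_min0 _ s0.
  exists h, (r ^+ 2 / 8) => //= h' hm'.
  rewrite -ball_normE /= -ltr_sqr ?nnegrE ?(ltW e0)// -q_norm er -rmorphXn ltcR.
  have := near_min_dist hm hm'; have := exprn_gt0 2 r0; lra.
pose g := lim F.
have gF (e e' : R) : 0 < e -> 0 < e' -> exists2 h, near_min e' h & `|g - h| < e%:C%C.
  move=> e0 e'0.
  have := cF _ (nbhsx_ballx g e%:C%C _); rewrite ltcR => /(_ e0) [s s0 sB].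
  have [|h hm] := near_min0 (Num.min s e'); first by rewrite lt_min s0.
  exists h; first by apply: near_minS hm; rewrite ge_min lexx orbT.
  have := sB h; rewrite -ball_normE; apply.
  by apply: near_minS hm; rewrite ge_min lexx.
exists g.
  apply/closureP => e e0.
  have [r er] : exists r : R, e = r%:C%C.
    by apply/complex_realP; rewrite realE ltW.
  have r0 : 0 < r by move: e0; rewrite er ltcR.
  by have [h [c Dhc _] gh] := gF _ _ r0 ltr01; rewrite er; exists h => //; exists c.
move=> k d Dkd; apply/eqP; rewrite -subr_eq0 -normr_le0; apply/ler_addgt0Pr => e e0.
have [r er] : exists r : R, e = r%:C%C.
  by apply/complex_realP; rewrite realE ltW.
have r0 : 0 < r by move: e0; rewrite er ltcR.
have k0 : 0 < q k + 1 by rewrite ltr_wpDl.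
(* The error is split in two halves r / 2: one is ['[k, h - g]], controlled by Cauchy-Schwarz and
   |k| <= |k|^2 + 1, the other is ['[k, h] - d], controlled by [near_min_dot]. *)
have rk : 0 < r / (2 * (q k + 1)) by rewrite divr_gt0 // mulr_gt0.
have rk' : 0 < (r / 2) ^+ 2 / (q k + 1) by rewrite divr_gt0 // exprn_gt0 // divr_gt0.
have [h [c Dhc Jc] gh] := gF _ _ rk rk'.
have dh : `|'[k, h] - d| <= (r / 2)%:C%C.
  rewrite -ler_sqr ?nnegrE //; last by rewrite ler0c ltW ?divr_gt0.
  rewrite normCK -rmorphXn /=.
  have := near_min_dot Dhc Jc Dkd; rewrite divfK ?gt_eqF//.
  set z := '[k, h] - d; case: z => x y /= xy.
  by rewrite lecE /=; apply/andP; split=> //; apply/eqP; ring.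
have khg : `|'[k, h - g]| <= (r / 2)%:C%C.
  apply: le_trans (CauchySchwarz_hdot _ _) _; rewrite distrC.
  have qk : `|k| <= (q k + 1)%:C%C.
    rewrite rmorphD /= q_norm; have := normr_ge0 k; have := normr_real k.
    move/complex_realP => [s ->]; rewrite -rmorphXn -rmorphD ler0c lecR /=; nra.
  apply: le_trans (ler_pM _ _ qk (ltW gh)) _ => //.
  rewrite -rmorphM lecR le_eqVlt; apply/orP; left; apply/eqP.
  by field; rewrite gt_eqF.
rewrite add0r er.
have -> : d - '[k, g] = - ('[k, h] - d) + '[k, h - g] by rewrite hdotBr; ring.
apply: le_trans (ler_normD _ _) _; rewrite normrN.
apply: le_trans (lerD dh khg) _.
rewrite -rmorphD lecR; lra.
Qed.

End Riesz.

(** * Orthogonal complements and orthogonal projection *)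

Section Subspaces.
Variables (R : realType) (H : hilbertType R).
Local Notation C := R[i].
Local Notation "''[' u , v ]" := (hdot u v) : ring_scope.
Implicit Types (A M : set H).

Lemma hdot_closure0 A z x :
  (forall y, A y -> '[z, y] = 0) -> closure A x -> '[z, x] = 0.
Proof.
move=> zA /closureP Ax; apply/eqP; rewrite -normr_le0; apply/ler_addgt0Pr => e e0.
rewrite add0r.
(* The added 1 keeps the denominator positive when [z = 0]. *)
have d0 : 0 < e / (`|z| + 1) by rewrite divr_gt0 // ltr_wpDl.
have [y Ay xy] := Ax _ d0.
have -> : '[z, x] = '[z, x - y] by rewrite hdotBr (zA y) // subr0.
apply: le_trans (CauchySchwarz_hdot _ _) _.
have z1 : `|z| <= `|z| + 1 by rewrite lerDl.
apply: le_trans (ler_pM _ _ z1 (ltW xy)) _ => //.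
by rewrite mulrC divfK // gt_eqF // ltr_wpDl.
Qed.

Lemma perp_sym A x y : perp A x -> A y -> '[y, x] = 0.
Proof. by move=> Ax Ay; rewrite hdotC Ax // conjC0. Qed.

Lemma perp_closed_subspace A : closed_subspace (perp A).
Proof.
split=> [y _|a x y Ax Ay z Az|x Ax y Ay]; first by rewrite hdot0l.
  by rewrite hdotDl hdotZl Ax // Ay // mulr0 addr0.
rewrite hdotC (hdot_closure0 _ Ax) ?conjC0 // => z Az.
exact: perp_sym Ay.
Qed.

Lemma closed_subspaceI A B :
  closed_subspace A -> closed_subspace B -> closed_subspace (A `&` B).
Proof.
move=> [A0 AD Ac] [B0 BD Bc]; split=> //; last exact: closedI.
by move=> a x y [Ax Bx] [Ay By]; split; [apply: AD|apply: BD].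
Qed.

(** The projection of [x] represents the functional h |-> ['[h, x]] restricted to [M]. *)
Lemma orthogonal_decomposition M x : closed_subspace M ->
  exists2 g, M g & perp M (x - g).
Proof.
move=> [M0 MD Mc].
pose D h (c : C) := M h /\ c = '[h, x].
have [||h c [Mh ->]|g Dg gE] := @Riesz_graph R H D (complex.Re `|x|).
- by split=> //; rewrite hdot0l.
- move=> a h c h' c' [Mh ->] [Mh' ->]; split; first exact: MD.
  by rewrite hdotDl hdotZl.
- rewrite RRe_real ?normr_real // mulrC; exact: CauchySchwarz_hdot.
exists g.
  by apply: Mc; apply: closure_subset Dg => h [c []].
by move=> y My; rewrite hdotC hdotBr -(gE y '[y, x]) // subrr conjC0.
Qed.

End Subspaces.

(** * Partial isometries: inner products and closed range *)

Section Partial_isometry.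
Variables (R : realType) (H K : hilbertType R).
Local Notation C := R[i].
Local Notation "''[' u , v ]" := (hdot u v) : ring_scope.
Variable P : {linear H -> K}.

Lemma op_ker_closed_subspace : bounded_operator P -> closed_subspace (op_ker P).
Proof.
move=> [M PM]; split=> [|a x y xP yP|x /closureP xP]; first exact: linear0.
  by rewrite /op_ker /= linearP xP yP scaler0 addr0.
apply/eqP; rewrite -normr_le0; apply/ler_addgt0Pr => e e0; rewrite add0r.
(* The bound [M] may be zero or negative, so a positive one replaces it. *)
have M1 : 0 < (`|M| + 1)%:C%C :> C by rewrite ltcR ltr_wpDl.
have [y yP xy] := xP _ (divr_gt0 e0 M1).
have -> : P x = P (x - y) by rewrite linearB yP subr0.
apply: le_trans (PM _) _.
apply: le_trans (_ : (`|M| + 1)%:C%C * `|x - y| <= e).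
  apply: ler_wpM2r => //; rewrite lecR (le_trans (ler_norm _)) // lerDl //.
by rewrite mulrC -ler_pdivlMr // ltW.
Qed.

Hypothesis P_pisom : partial_isometry P.
Local Notation N := (perp (op_ker P)).

Lemma partial_isometry_split f : exists2 g, N g & P g = P f.
Proof.
have [g kg gN] := orthogonal_decomposition f (op_ker_closed_subspace P_pisom.1).
by exists (f - g) => //; rewrite linearB kg subr0.
Qed.

(** Polarization: norms of sums in [N] give the real part, and replacing [f] by i f gives the
    imaginary part. An arbitrary [g] is first replaced by its component in [N], which changes
    neither side. *)
Lemma partial_isometry_hdot f g : N f -> '[P f, P g] = '[f, g].
Proof.
move=> Nf.
have [_ ND _] := perp_closed_subspace (op_ker P).
have sq x : N x -> '[P x, P x] = '[x, x].
  by move=> Nx; rewrite !hdot_norm P_pisom.2.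
have reE x y : N x -> N y -> complex.Re '[P x, P y] = complex.Re '[x, y].
  move=> Nx Ny; have := sq (1 *: x + y) (ND 1 x y Nx Ny).
  rewrite scale1r linearD /= !hdotDl !hdotDr !sq // (hdotC (P y) (P x)) (hdotC y x).
  move=> /(congr1 (@complex.Re R)); rewrite !ReD !Re_conj; lra.
have [g' Ng' Pg'] := partial_isometry_split g.
have -> : '[f, g] = '[f, g'].
  apply/eqP; rewrite -subr_eq0 -hdotBr Nf // /op_ker /= linearB Pg' subrr.
  by [].
rewrite -Pg'.
have Nif : N ('i%C *: f) by rewrite -[_ *: f]addr0; apply: ND => // y _; rewrite hdot0l.
have := reE _ _ Nf Ng'; have := reE _ _ Nif Ng'.
rewrite linearZ /= !hdotZl.
by case: '[P f, P g'] => a b; case: '[f, g'] => c d /= h1 h2; congr (_ +i* _)%C; lra.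
Qed.

(** For [x] in the closure, Riesz applied to h |-> ['[P h, x]] on [N] yields the adjoint image [g]
    of [x]. Then [x - P g] is orthogonal to the range, hence to its closure and to itself. *)
Lemma range_closed_subspace : closed_subspace (range P).
Proof.
split; first by exists 0 => //; rewrite linear0.
  by move=> a _ _ [f _ <-] [g _ <-]; exists (a *: f + g) => //; rewrite linearP.
move=> x Sx.
have [N0 ND Nc] := perp_closed_subspace (op_ker P).
pose D h (c : C) := N h /\ c = '[P h, x].
have [||h c [Nh ->]|g Dg gE] := @Riesz_graph R H D (complex.Re `|x|).
- by split=> //; rewrite linear0 hdot0l.
- move=> a h c h' c' [Nh ->] [Nh' ->]; split; first exact: ND.
  by rewrite linearP hdotDl hdotZl.
- rewrite RRe_real ?normr_real // mulrC -(P_pisom.2 h) //; exact: CauchySchwarz_hdot.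
have Ng : N g by apply: Nc; apply: closure_subset Dg => h [c []].
have xg y : range P y -> '[x - P g, y] = 0.
  move=> [f _ <-]; have [f' Nf' <-] := partial_isometry_split f.
  rewrite hdotC hdotBr partial_isometry_hdot // -(gE f' '[P f', x]) //.
  by rewrite subrr conjC0.
exists g => //; apply/eqP; rewrite eq_sym -subr_eq0; apply/eqP/hdot_eq0.
rewrite hdotBr (xg (P g)) ?subr0; last by exists g.
exact: hdot_closure0 xg Sx.
Qed.

End Partial_isometry.

(** * Coordinate multipliers and constants in the Drury-Arveson space *)

Section Drury_Arveson.
Variables (R : realType) (n : nat) (E : hilbertType R) (F : drury_arveson n E).
Local Notation C := R[i].
Local Notation "''[' u , v ]" := (hdot u v) : ring_scope.
Local Notation ball := (unit_ball R n).
Implicit Types (z w : ball) (e : E) (f g : F) (i : 'I_n).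

Let ev f z : E := rkhs_fun F f z.
Let k w e : F := rkhs_ker F w e.

Definition ball_dot z w : C := \sum_(i < n) ball_coord z i * Num.conj (ball_coord w i).

(** Summing |a b| <= (|a|^2 + |b|^2) / 2 over the coordinates gives modulus strictly below 1. *)
Lemma ball_dot_neq1 z w : 1 - ball_dot z w != 0.
Proof.
rewrite subr_eq0; apply/eqP => zw1.
have : `|ball_dot z w| <=
    2^-1 * (\sum_(i < n) `|ball_coord z i| ^+ 2 + \sum_(i < n) `|ball_coord w i| ^+ 2).
  apply: le_trans (ler_norm_sum _ _ _) _.
  rewrite -big_split /= mulr_sumr; apply: ler_sum => i _.
  rewrite normrM norm_conjC -subr_ge0.
  set a := `|_|; set b := `|_|.
  have -> : 2^-1 * (a ^+ 2 + b ^+ 2) - a * b = 2^-1 * (a - b) ^+ 2 by field.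
  by rewrite mulr_ge0 ?invr_ge0 // real_exprn_even_ge0 // rpredB ?normr_real.
rewrite -zw1 normr1 => h.
have : (1 : C) < 1; last by rewrite ltxx.
apply: le_lt_trans h _; rewrite mulrC ltr_pdivrMr // mul1r.
by rewrite [ltRHS](_ : _ = 1 + 1) // ltrD //; [exact: (valP z)|exact: (valP w)].
Qed.

Let kdot w e w' e' : '[k w e, k w' e'] = (1 - ball_dot w' w)^-1 * '[e, e'].
Proof. by rewrite rkhs_reproducing rkhs_kerE hdotZl. Qed.

Let evdot f w e : '[f, k w e] = '[ev f w, e].
Proof. exact: rkhs_reproducing. Qed.

Let evI f g : (forall z, ev f z = ev g z) -> f = g.
Proof. by move=> fg; apply: (@rkhs_fun_inj _ _ _ _ F); apply/funext. Qed.

(** A triple is a coefficient, a point and a vector. The weight [cst 1] gives [h], and [coord_bar i]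
    gives A_i h. Working with lists leaves open whether A_i h depends on [h] alone. *)
Let kernel_sum (s : seq (C * ball * E)) (phi : ball -> C) : F :=
  \sum_(t <- s) (t.1.1 * phi t.1.2) *: k t.1.2 t.2.

Let coord_bar i w : C := Num.conj (ball_coord w i).

(** For each pair of terms the factor [1 - ball_dot w' w] produced by the difference cancels the
    kernel. *)
Let kernel_sum_norm s :
  '[kernel_sum s (cst 1), kernel_sum s (cst 1)] -
    \sum_i '[kernel_sum s (coord_bar i), kernel_sum s (coord_bar i)] =
  '[\sum_(t <- s) t.1.1 *: t.2, \sum_(t <- s) t.1.1 *: t.2].
Proof.
have sumE phi : '[kernel_sum s phi, kernel_sum s phi] = \sum_(t <- s) \sum_(t' <- s)
    t.1.1 * Num.conj t'.1.1 * '[t.2, t'.2] *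
    ((1 - ball_dot t'.1.2 t.1.2)^-1 * (phi t.1.2 * Num.conj (phi t'.1.2))).
  rewrite hdot_suml; apply: eq_bigr => t _; rewrite hdot_sumr; apply: eq_bigr => t' _.
  by rewrite hdotZl hdotZr kdot rmorphM /=; ring.
rewrite (eq_bigr _ (fun i _ => sumE (coord_bar i))) sumE [X in _ - X]exchange_big /= -sumrB.
rewrite hdot_suml; apply: eq_bigr => t _.
rewrite [X in _ - X]exchange_big /= -sumrB hdot_sumr; apply: eq_bigr => t' _.
rewrite -mulr_sumr -mulrBr -mulr_sumr.
have -> : \sum_i coord_bar i t.1.2 * Num.conj (coord_bar i t'.1.2) =
    ball_dot t'.1.2 t.1.2.
  by apply: eq_bigr => i _; rewrite /coord_bar conjCK mulrC.
rewrite /cst conjC1 mulr1 -mulrBr mulVf ?ball_dot_neq1 // mulr1.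
by rewrite hdotZl hdotZr; ring.
Qed.

Let kernel_sum_contraction s i :
  `|kernel_sum s (coord_bar i)| <= `|kernel_sum s (cst 1)|.
Proof.
rewrite -ler_sqr ?nnegrE // -!hdot_norm -subr_ge0.
have := kernel_sum_norm s; rewrite (bigD1 i) //= opprD addrA => /eqP.
rewrite subr_eq => /eqP ->.
by rewrite addr_ge0 ?dnorm_ge0 // sumr_ge0 // => j _; exact: dnorm_ge0.
Qed.

(** The function [g] is the adjoint of A_i applied to [f], obtained by representing h |-> <A_i h,
    f>, whose bound |f| comes from the contraction. *)
Lemma coord_multiplier f i : exists g, forall z, ev g z = ball_coord z i *: ev f z.
Proof.
pose D h (c : C) := exists s, h = kernel_sum s (cst 1) /\
  c = '[kernel_sum s (coord_bar i), f].
have kernel_sumP a s s' : exists s'',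
    forall phi, kernel_sum s'' phi = a *: kernel_sum s phi + kernel_sum s' phi.
  exists ([seq (a * t.1.1, t.1.2, t.2) | t <- s] ++ s') => psi.
  rewrite /kernel_sum big_cat big_map /= scaler_sumr; congr (_ + _).
  by apply: eq_bigr => t _; rewrite scalerA mulrA.
have [||h c [s [-> ->]]|g _ gE] := @Riesz_graph R F D (complex.Re `|f|).
- by exists [::]; rewrite /kernel_sum !big_nil hdot0l.
- move=> a h c h' c' [s [-> ->]] [s' [-> ->]].
  have [s'' s''E] := kernel_sumP a s s'.
  by exists s''; rewrite !s''E hdotDl hdotZl.
- rewrite RRe_real ?normr_real // mulrC.
  apply: le_trans (CauchySchwarz_hdot _ _) _.
  by rewrite ler_wpM2r.
(* Testing [g] against the one-term sum [k z e] reads off its value at [z]. *)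
exists g => z; apply: hdot_injr => e.
rewrite hdotZr !(hdotC e) -!evdot -!(hdotC (k z e)).
rewrite -(gE (k z e) (coord_bar i z * '[k z e, f])) //.
by exists [:: (1, z, e)]; rewrite /kernel_sum !big_seq1 /= !mul1r scale1r hdotZl.
Qed.

Lemma MzE i f z : ev (Mz i f) z = ball_coord z i *: ev f z.
Proof.
have [g gE] := coord_multiplier f i.
pose A := [set g : F | forall z, rkhs_fun F g z = ball_coord z i *: rkhs_fun F f z].
exact: (xgetPex 0 (ex_intro A g gE)).
Qed.

Lemma ball_origin_subproof : \sum_(i < n) `|(0 : 'rV[C]_n) 0 i| ^+ 2 < 1.
Proof. by rewrite big1 // => i _; rewrite mxE normr0 expr0n. Qed.

Definition ball_origin : ball := exist _ 0 ball_origin_subproof.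

Lemma ball_coord0 i : ball_coord ball_origin i = 0.
Proof. by rewrite /ball_coord mxE. Qed.

Let ev_k0 e z : ev (k ball_origin e) z = e.
Proof.
rewrite /ev rkhs_kerE /drury_arveson_kernel big1 ?subr0 ?invr1 ?scale1r // => i _.
by rewrite ball_coord0 conjC0 mulr0.
Qed.

Let evD f g z : ev (f + g) z = ev f z + ev g z.
Proof. by rewrite /ev linearD. Qed.

Let evB f g z : ev (f - g) z = ev f z - ev g z.
Proof. by rewrite /ev linearB. Qed.

Let evZ a f z : ev (a *: f) z = a *: ev f z.
Proof. by rewrite /ev linearZ. Qed.

Let ev_sum (G : 'I_n -> F) z : ev (\sum_i G i) z = \sum_i ev (G i) z.
Proof.
by elim/big_ind2 : _ => // [|? ? ? ? <- <-]; rewrite ?evD // /ev linear0.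
Qed.

(** Pointwise this is 1 / (1 - x) = 1 + x / (1 - x) with x = [ball_dot z w]. *)
Let kernel_split w e : k w e =
  k ball_origin e + \sum_i coord_bar i w *: Mz i (k w e).
Proof.
apply: evI => z; rewrite evD ev_k0 ev_sum.
have kE : ev (k w e) z = (1 - ball_dot z w)^-1 *: e by rewrite /ev rkhs_kerE.
rewrite (eq_bigr (fun i =>
    (ball_coord z i * Num.conj (ball_coord w i)) *: ev (k w e) z)); last first.
  by move=> i _; rewrite evZ MzE scalerA mulrC.
rewrite -scaler_suml -/(ball_dot z w) kE scalerA -[X in _ = X + _]scale1r -scalerDl.
by congr (_ *: _); field; exact: ball_dot_neq1.
Qed.

(** The constant [e] is the kernel function at the origin, where every [Mz i g] vanishes.
    Conversely, [f] minus its value at the origin is orthogonal to both parts of [kernel_split],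
    hence to all kernel functions. *)
Lemma constantsP f :
  constants f <-> forall i g, '[f, Mz i g] = 0.
Proof.
have k0_Mz e i g : '[k ball_origin e, Mz i g] = 0.
  by rewrite hdotC evdot MzE ball_coord0 scale0r hdot0l conjC0.
split=> [[e fe] i g|fMz].
  suff -> : f = k ball_origin e by [].
  by apply: evI => z; rewrite ev_k0; exact: fe.
suff -> : f = k ball_origin (ev f ball_origin).
  by exists (ev f ball_origin) => z; exact: ev_k0.
apply/eqP; rewrite -subr_eq0; set f' := f - _; apply/eqP.
apply: evI => w; rewrite {2}/ev linear0; apply: hdot_eq0.
rewrite -evdot kernel_split hdotDr evdot evB ev_k0 subrr hdot0l add0r.
rewrite hdot_sumr big1 // => i _.
by rewrite hdotZr hdotBl fMz k0_Mz subrr mulr0.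
Qed.

End Drury_Arveson.

(** * Powers of a commuting tuple on an invariant subspace *)

Section Tuples.
Variables (R : realType) (n : nat) (H : hilbertType R) (T : 'I_n -> {linear H -> H}).
Variable S : set H.
Hypothesis S0 : S 0.

Lemma sum_images_mem i x : S x -> sum_images T S (T i x).
Proof.
move=> Sx; exists (fun j => if j == i then x else 0).
  by move=> j; case: ifP.
by rewrite (bigD1 i) //= eqxx big1 ?addr0 // => j /negbTE ->; rewrite linear0.
Qed.

Hypothesis T_commuting : commuting_tuple T.
Hypothesis S_invariant : invariant_subspace T S.

Lemma sum_images_invariant : invariant_subspace T (sum_images T S).
Proof.
move=> i _ [s Ss ->]; exists (T i \o s) => [j|] /=; first exact/S_invariant/Ss.
by rewrite linear_sum; apply: eq_bigr => j _; rewrite T_commuting.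
Qed.

(** This yields the wandering property: a vector orthogonal to all T_i S is orthogonal to every
    nontrivial power of the tuple on [S]. *)
Lemma tuple_pow_mem (k : 'I_n -> nat) x : (exists i, k i != 0%N) -> S x ->
  sum_images T S (tuple_pow T k x).
Proof.
move=> [i ki] Sx; rewrite /tuple_pow.
have : i \in index_enum 'I_n by rewrite mem_index_enum.
have iterP (A : set H) j y m :
    invariant_subspace T A -> A y -> A (iter m (T j) y).
  by move=> TA Ay; elim: m => //= m IHm; exact: TA.
elim: (index_enum _) => [//|j r IHr]; rewrite in_cons big_cons /= => ijr.
(* If [i] occurs in the tail, the head power preserves [sum_images T S]. Otherwise [i] is the head:
   the tail stays in [S], the first [T i] enters [sum_images T S] as the outermost factor. *)
have [ir|inr] := boolP (i \in r).
  by apply: iterP (IHr ir); exact: sum_images_invariant.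
move: ijr; rewrite (negbTE inr) orbF => /eqP <-; case: (k i) ki => //= m _; apply: sum_images_mem.
apply: (iterP S) => //; elim: r {IHr inr} => [|l r IHr]; first by rewrite big_nil.
by rewrite big_cons /=; exact: (iterP S).
Qed.

End Tuples.

Theorem theorem5p2 (R : realType) (n : nat) (H E : hilbertType R)
    (T : 'I_n -> {linear H -> H})
    (T_bounded : forall i, bounded_operator (T i))
    (T_commuting : commuting_tuple T)
    (H2 : drury_arveson n E)
    (P : {linear H2 -> H})
    (P_pisom : partial_isometry P)
    (P_intertwines : forall (i : 'I_n) (f : H2), P (Mz i f) = T i (P f)) :
  let S := range P in
  let W := ominus S (sum_images T S) in
  [/\ closed_subspace S,
      invariant_subspace T S,
      wandering_restr T S W
    & W = P @` (perp (op_ker P) `&` @constants R n E H2)].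
Proof.
move=> S W.
have Sclosed : closed_subspace S := range_closed_subspace P_pisom.
have S0 : S 0 by case: Sclosed.
have Sinv : invariant_subspace T S.
  by move=> i _ [f _ <-]; exists (Mz i f).
split=> //.
  split=> //; [exact: closed_subspaceI (perp_closed_subspace _)|by move=> x []|].
  move=> k k0 x _ [_ xperp] [y [Sy _] <-]; apply: xperp.
  exact: tuple_pow_mem.
apply/seteqP; split=> [_ [[f0 _ <-] f0perp]|_ [f [Nf /constantsP fMz] <-]].
  (* A preimage in (ker P)^perp is chosen, so that [P] preserves its inner products with all
     [Mz i g]. *)
  have [f Nf Pf] := partial_isometry_split P_pisom f0.
  exists f => //; split=> //; apply/constantsP => i g.
  rewrite -(partial_isometry_hdot P_pisom _ Nf) P_intertwines Pf.
  by apply: f0perp; apply: sum_images_mem => //; exists g.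
split; first by exists f.
move=> _ [s Ss ->]; rewrite hdot_sumr big1 // => i _.
have [g _ <-] := Ss i.
by rewrite -P_intertwines (partial_isometry_hdot P_pisom).
Qed.
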